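(* Let $n,p$ be positive integers with $p\le n$. Every NUOBDD computing $\mathtt{MOD}^p_n$ has width at least $p$.
   Context: $\mathtt{MOD}^p_n:\{0,1\}^n\to\{0,1\}$ equals 1 iff the number of ones in the input is congruent to $0$ modulo $p$. A unitary OBDD (UOBDD) of width $d$ on $n$ variables is $(Q,|\psi^0\rangle,T,Q_{acc})$: $Q=\{q_1,\dots,q_d\}$ indexes an orthonormal basis of $\mathbb{C}^d$, $|\psi^0\rangle$ a unit vector, $Q_{acc}\subseteq Q$, $T=((i_j,U_j(0),U_j(1)))_{j=1}^n$ with $(i_1,\dots,i_n)$ a permutation of $\{1,\dots,n\}$ and $U_j(b)$ unitary $d\times d$ matrices. On input $\sigma$ the final state is $|\psi^n\rangle=U_n(\sigma_{i_n})\cdots U_1(\sigma_{i_1})|\psi^0\rangle$ and the acceptance probability is $\|P_{acc}|\psi^n\rangle\|^2$ with $P_{acc}$ the projection onto the span of accepting basis states. An NUOBDD computes $f$ if for all $\sigma$: $f(\sigma)=1$ iff the acceptance probability is nonzero. Its width is $d$. *)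

(* Defs.v *)
From mathcomp Require Import all_boot all_order all_algebra all_fingroup.
From mathcomp Require Import reals complex.

Set Implicit Arguments.
Unset Strict Implicit.
Unset Printing Implicit Defensive.

Import Order.TTheory GRing.Theory Num.Theory.
Local Open Scope ring_scope.

Definition MOD (p n : nat) (sigma : n.-tuple bool) : bool :=
  (count_mem true sigma == 0 %[mod p])%N.

Definition sqnorm (R : realType) (d : nat) (v : 'cV[R[i]]_d) : R[i] :=
  \sum_(k < d) `|v k 0| ^+ 2.

(* A unitary OBDD of width d on n variables; C is R[i], the basis of C^d is
   the standard one.  Steps and variables are numbered from 0: step j reads the
   variable [uorder j] and then applies [utrans j b], where b is the bit read. *)
Record UOBDD (R : realType) (n d : nat) := {
  uinit : 'cV[R[i]]_d;
  uorder : 'S_n;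
  utrans : 'I_n -> bool -> 'M[R[i]]_d;
  uacc : {set 'I_d};
  uinit_unit : sqnorm uinit = 1;
  utrans_unitary : forall (j : 'I_n) (b : bool), utrans j b \is unitarymx
}.

(* [enum 'I_n] is increasing, so the transformation of step 0 is applied
   first. *)
Definition final_state (R : realType) (n d : nat) (B : UOBDD R n d)
    (sigma : n.-tuple bool) : 'cV[R[i]]_d :=
  foldl (fun psi j => utrans B j (tnth sigma (uorder B j)) *m psi)
    (uinit B) (enum 'I_n).

Definition acc_proj (R : realType) (n d : nat) (B : UOBDD R n d) : 'M[R[i]]_d :=
  diag_mx (\row_(k < d) (k \in uacc B)%:R).

Definition acc_prob (R : realType) (n d : nat) (B : UOBDD R n d)
    (sigma : n.-tuple bool) : R[i] :=
  sqnorm (acc_proj B *m final_state B sigma).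

Definition NUOBDD_computes (R : realType) (n d : nat) (B : UOBDD R n d)
    (f : n.-tuple bool -> bool) : Prop :=
  forall sigma : n.-tuple bool, f sigma = true <-> acc_prob B sigma <> 0.

(* Main.v *)
Require Import Defs.
From mathcomp Require Import all_boot all_order all_algebra all_fingroup.
From mathcomp Require Import reals complex.

(** Let [stepped k a] be the state after the first [k] steps when they read the
    bits [0^a 1^(k-a)], [a <= k < p]. For fixed [k] these [k+1] vectors are
    linearly independent, by induction on [k]: reading only zeros from step [k]
    on and then projecting sends [stepped k k] to a nonzero vector (the input
    has no ones) and [stepped k a], [a < k], to zero (the input has [k - a]
    ones, [0 < k - a < p]), so [stepped k k] has coefficient 0 in every linear
    relation; the other vectors are the images of the [stepped (k-1) a] under
    one unitary, hence injective, map. For [k = p - 1] this gives [p]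
    independent vectors in dimension [d]. *)

Set Implicit Arguments.
Unset Strict Implicit.
Unset Printing Implicit Defensive.

Import Order.TTheory GRing.Theory Num.Theory.
Local Open Scope ring_scope.

(** Each row of the kernel matrix of [A^T] transposes to a column killed by [A], so [A^T] has full
    row rank [n], which is at most its number [m] of columns. *)
Lemma leq_of_mulmx_inj (F : fieldType) (m n : nat) (A : 'M[F]_(m, n)) :
  (forall x : 'cV[F]_n, A *m x = 0 -> x = 0) -> (n <= m)%N.
Proof.
move=> injA; suff /eqP <- : row_free A^T by exact: rank_leq_col.
rewrite -kermx_eq0; apply/eqP/row_matrixP => i; rewrite row0.
apply: trmx_inj; rewrite trmx0; apply: injA.
by apply: trmx_inj; rewrite trmx_mul trmxK -row_mul mulmx_ker row0 trmx0.
Qed.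

Lemma sqnorm_eq0 (R : realType) (d : nat) (v : 'cV[R[i]]_d) :
  sqnorm v = 0 <-> v = 0.
Proof.
split=> [|->]; last first.
  by rewrite /sqnorm big1 // => k _; rewrite mxE normr0 expr0n.
move=> /psumr_eq0P v0; apply/colP => k; rewrite mxE.
have /eqP := v0 (fun i _ => exprn_ge0 2 (normr_ge0 _)) k isT.
by rewrite sqrf_eq0 normr_eq0 => /eqP.
Qed.

Lemma count_iota_interval (n a k : nat) : (a <= k <= n)%N ->
  count (fun i => a <= i < k)%N (iota 0 n) = (k - a)%N.
Proof.
move=> /andP[ak kn].
have -> : iota 0 n = iota 0 a ++ iota a (k - a) ++ iota k (n - k).
  rewrite -[X in _ ++ _ ++ iota X _](subnKC ak) -iotaD.
  by rewrite -[X in _ ++ iota X _]add0n -iotaD addnA !subnKC.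
rewrite !count_cat.
rewrite (@eq_in_count _ _ pred0) => [|i]; last first.
  by rewrite mem_iota /= add0n => ia; rewrite leqNgt ia.
rewrite (@eq_in_count _ _ predT (iota a _)) => [|i]; last first.
  by rewrite mem_iota subnKC.
rewrite (@eq_in_count _ _ pred0 (iota k _)) => [|i]; last first.
  by rewrite mem_iota => /andP[ki _]; rewrite (ltnNge i) ki andbF.
by rewrite !count_pred0 count_predT size_iota addn0.
Qed.

Section Run.
Variables (R : realType) (n d : nat) (B : UOBDD R n d).

(* The bit [w j] is the one read at step [j], whichever variable that is. *)
Definition run (w : nat -> bool) (s : seq 'I_n) (psi : 'cV[R[i]]_d) :=
  foldl (fun psi (j : 'I_n) => utrans B j (w j) *m psi) psi s.

(** The inverse of the reading order turns bits listed by step into bits listed by variable. *)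
Definition input_of (w : nat -> bool) : n.-tuple bool :=
  [tuple w ((uorder B)^-1%g i) | i < n].

Lemma final_state_input_of w :
  final_state B (input_of w) = run w (enum 'I_n) (uinit B).
Proof.
rewrite /final_state /run; elim: (enum _) (uinit B) => //= j s IHs psi.
by rewrite tnth_mktuple permK IHs.
Qed.

Lemma count_input_of w : count_mem true (input_of w) = count w (iota 0 n).
Proof.
have perm_order :
    perm_eq [seq (uorder B)^-1%g i | i <- enum 'I_n] (enum 'I_n).
  apply: uniq_perm => [||i]; do ?exact: enum_uniq.
    by rewrite (map_inj_uniq perm_inj) enum_uniq.
  rewrite mem_enum; apply/mapP; exists (uorder B i).
    by rewrite mem_enum.
  by rewrite permK.
rewrite -(val_enum_ord n) count_map -(seq.permP perm_order) !count_map.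
by apply: eq_count => i /=; rewrite eqb_id.
Qed.

Lemma run_cat w s1 s2 psi : run w (s1 ++ s2) psi = run w s2 (run w s1 psi).
Proof. exact: foldl_cat. Qed.

(** Lets a linear relation between states be pushed through a run. *)
Lemma run_mulmx w s : exists M : 'M_d, forall psi, run w s psi = M *m psi.
Proof.
elim: s => [|j s [M IH]]; first by exists 1%:M => psi; rewrite mul1mx.
exists (M *m utrans B j (w j)) => psi.
by rewrite /run /= -/(run _ _ _) IH mulmxA.
Qed.

Lemma eq_run (w1 w2 : nat -> bool) (s : seq 'I_n) psi :
  {in s, forall j : 'I_n, w1 j = w2 j} -> run w1 s psi = run w2 s psi.
Proof.
elim: s psi => //= j s IH psi eqw; rewrite eqw ?mem_head //.
by apply: IH => i si; rewrite eqw // in_cons si orbT.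
Qed.

(** The predicate is false from [k] on, so it also describes the full input that continues with
    zeros. *)
Definition stepped (k a : nat) : 'cV[R[i]]_d :=
  run (fun i => a <= i < k)%N (take k (enum 'I_n)) (uinit B).

(** As [a <= k], step [k] reads a one, so the matrix is the same for all such [a]. *)
Lemma steppedS k a (kn : (k < n)%N) : (a <= k)%N ->
  stepped k.+1 a = utrans B (Ordinal kn) true *m stepped k a.
Proof.
move=> ak; rewrite /stepped (take_nth (Ordinal kn)) ?size_enum_ord //.
rewrite -cats1 run_cat.
have -> : nth (Ordinal kn) (enum 'I_n) k = Ordinal kn.
  by apply: val_inj; rewrite /= nth_enum_ord.
(* The two words differ only at index [k], which the first [k] steps do not reach. *)
rewrite [LHS]/= ak ltnSn; congr (_ *m _); apply: eq_run => j.
rewrite -(mem_map val_inj) map_take val_enum_ord take_iota mem_iota.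
rewrite (minn_idPl (ltnW kn)) add0n /= => jk.
by rewrite jk ltnS (ltnW jk).
Qed.

Lemma stepped_final k a : (k <= n)%N ->
  final_state B (input_of (fun i => a <= i < k)%N) =
  run xpred0 (drop k (enum 'I_n)) (stepped k a).
Proof.
move=> kn; rewrite final_state_input_of -{1}(cat_take_drop k (enum 'I_n)).
rewrite run_cat /stepped -(eq_run (w1 := fun i => a <= i < k)%N) // => j.
rewrite -(mem_map val_inj) map_drop val_enum_ord drop_iota mem_iota add0n.
by move=> /andP[kj _]; rewrite [(j < k)%N]ltnNge kj andbF.
Qed.

Lemma NUOBDD_computes_final_neq0 f sigma : NUOBDD_computes B f ->
  f sigma = (acc_proj B *m final_state B sigma != 0).
Proof.
move=> /(_ sigma) [fP Pf]; apply/idP/idP => [/fP prob|/eqP st].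
  by apply/eqP => /sqnorm_eq0.
by apply: Pf => /sqnorm_eq0.
Qed.

Lemma MOD_interval p k a : (a <= k)%N -> (k < p)%N -> (k <= n)%N ->
  MOD p (input_of (fun i => a <= i < k)%N) = (a == k).
Proof.
move=> ak kp kn; rewrite /MOD count_input_of count_iota_interval ?ak //.
rewrite mod0n modn_small ?(leq_ltn_trans (leq_subr _ _)) // subn_eq0.
by rewrite eqn_leq ak.
Qed.

Lemma stepped_last_coef p k (c : nat -> R[i]) :
  NUOBDD_computes B (@MOD p n) -> (k < p)%N -> (k <= n)%N ->
  \sum_(a < k.+1) c a *: stepped k a = 0 -> c k = 0.
Proof.
move=> cB kp kn sum0; have [M runM] := run_mulmx xpred0 (drop k (enum 'I_n)).
(* The remaining bits are zeros whatever [a] is, so a single [M] serves for all [a]. *)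
have accE a : (a <= k)%N -> (acc_proj B *m M *m stepped k a != 0) = (a == k).
  move=> ak; rewrite -(MOD_interval ak kp kn).
  by rewrite (NUOBDD_computes_final_neq0 _ cB) stepped_final // runM mulmxA.
have := congr1 (mulmx (acc_proj B *m M)) sum0.
rewrite mulmx0 mulmx_sumr big_ord_recr big1 /= => [|a _]; last first.
  have /negbFE/eqP Ma0 :=
    etrans (accE a (ltnW (ltn_ord a))) (ltn_eqF (ltn_ord a)).
  by rewrite -scalemxAr Ma0 scaler0.
move/eqP; rewrite add0r -scalemxAr scaler_eq0 => /orP[/eqP //|Mk0].
by have := accE k (leqnn k); rewrite Mk0 eqxx.
Qed.

Lemma stepped_free p k (c : nat -> R[i]) :
  NUOBDD_computes B (@MOD p n) -> (k < p)%N -> (k <= n)%N ->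
  \sum_(a < k.+1) c a *: stepped k a = 0 ->
  forall a, (a <= k)%N -> c a = 0.
Proof.
move=> cB; elim: k => [|k IH] kp kn sum0 a.
all: have ck := stepped_last_coef cB kp kn sum0.
  by rewrite leqn0 => /eqP ->.
rewrite leq_eqVlt => /predU1P[-> //|ak]; apply: IH => //; do ?exact: ltnW.
have U_unit := unitarymx_unit (utrans_unitary B (Ordinal kn) true).
(* Applying the invertible matrix of step [k] to the shorter sum gives [sum0] without its last term,
   which vanishes by [ck]. *)
rewrite -[LHS](mulKmx U_unit) mulmx_sumr.
rewrite -[RHS](mulmx0 _ (invmx (utrans B (Ordinal kn) true))).
congr (_ *m _); rewrite -[RHS]sum0 [RHS]big_ord_recr /= ck scale0r addr0.
by apply: eq_bigr => b _; rewrite steppedS -?scalemxAr // -ltnS.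
Qed.

End Run.

Theorem theorem11 (R : realType) (n p d : nat) (B : UOBDD R n d) :
  (0 < n)%N -> (0 < p)%N -> (p <= n)%N ->
  NUOBDD_computes B (@MOD p n) ->
  (p <= d)%N.
Proof.
(* From here on the modulus is [p.+1], and the states after [p] steps form its [p.+1] columns. *)
case: p => // p _ _ pn cB.
apply: (@leq_of_mulmx_inj _ _ _ (\matrix_(i < d, a < p.+1) stepped B p a i 0)).
move=> x Ax0; apply/colP => a; rewrite mxE -[a]inord_val.
(* [inord] extends the coefficients to all naturals; only indices up to [p] matter. *)
apply: (stepped_free (c := fun a => x (inord a) 0) cB (ltnSn p) (ltnW pn)).
  rewrite -[RHS]Ax0; apply/colP => i; rewrite !mxE summxE.
  by apply: eq_bigr => b _; rewrite !mxE inord_val mulrC.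
by rewrite -ltnS.
Qed.
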